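(* Let $X$ be a real Banach space and let $f:X\to\mathbb{R}\cup\{\infty\}$ be a locally Lipschitz function with convex domain $\mathrm{dom}\, f$. Let $D\subseteq\mathrm{dom}\, f$ be self segment-dense in $\mathrm{dom}\, f$, and assume that $f$ is locally strictly pseudoconvex on $D$. If the Clarke–Rockafellar subdifferential $\partial^{\uparrow}f$ is lower semicontinuous and has the property that $\langle z^*,x-y\rangle\neq0$ for all $x,y\in\mathrm{dom}\, f$ with $x\neq y$, all $z\in[x,y]\cap (X\setminus D)$ and all $z^*\in\partial^{\uparrow}f(z)$, then $f$ is (globally) strictly pseudoconvex on $X$.
   Context: $X^*$ is the topological dual of $X$, $\langle x^*,x\rangle=x^*(x)$, and $[x,y]=\{x+t(y-x):t\in[0,1]\}$. $\mathrm{dom}\, f=\{x\in X: f(x)\in\mathbb{R}\}$. $f$ is locally Lipschitz if every $x\in\mathrm{dom}\, f$ has an open neighborhood in $X$ on which $f$ is finite and Lipschitz. For $x$ with $f(x)\in\mathbb{R}$ and $v\in X$, the Clarke–Rockafellar generalized derivative is $$f^{\uparrow}(x,v)=\sup_{\epsilon>0}\ \limsup_{(y,\alpha)\downarrow_f x,\ t\downarrow0}\ \inf_{u\in B(v,\epsilon)}\frac{f(y+tu)-\alpha}{t},$$ where $(y,\alpha)\downarrow_f x$ means $y\to x$, $\alpha\to f(x)$, $\alpha\ge f(y)$, and $B(v,\epsilon)$ is the open ball. (For locally Lipschitz $f$ this equals the Clarke directional derivative $\limsup_{y\to x,\,u\to v,\,t\downarrow0}\frac{f(y+tu)-f(y)}{t}$.)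 The Clarke–Rockafellar subdifferential is $\partial^{\uparrow}f(x)=\{x^*\in X^*:\langle x^*,v\rangle\le f^{\uparrow}(x,v)\ \forall v\in X\}$ (empty if $f(x)=\infty$). A set-valued $T:X\rightrightarrows X^*$ with domain $D(T)=\{x:T(x)\neq\emptyset\}$ is lower semicontinuous if for every $x\in D(T)$ and every (norm-)open $N\subseteq X^*$ with $T(x)\cap N\neq\emptyset$ there is a neighborhood $M$ of $x$ with $T(y)\cap N\ne\emptyset$ for all $y\in M\cap D(T)$. $P\subseteq S$ is dense in $S$ if $S\subseteq\mathrm{cl}(P)$. For $U\subseteq V\subseteq X$ with $V$ convex, $U$ is self segment-dense in $V$ if $U$ is dense in $V$ and for all $x,y\in U$ the set $[x,y]\cap U$ is dense in $[x,y]$. $f$ is strictly pseudoconvex if for all $x,y\in\mathrm{dom}\, f$ with $x\neq y$: $f(y)\le f(x)\Rightarrow\langle x^*,y-x\rangle<0$ for all $x^*\in\partial^{\uparrow}f(x)$. $f$ is locally strictly pseudoconvex on $D$ if every $z\in D$ has an open neighborhood $U_z$ such that for all $x,y\in U_z\cap D$ with $x\neq y$: $f(y)\le f(x)\Rightarrow\langle x^*,y-x\rangle<0$ for all $x^*\in\partial^{\uparrow}f(x)$. *)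

(* Defs.v *)
From HB Require Import structures.
From mathcomp Require Import all_boot all_order all_algebra.
From mathcomp Require Import all_classical all_reals all_analysis.

Set Implicit Arguments.
Unset Strict Implicit.
Unset Printing Implicit Defensive.

Import Order.TTheory GRing.Theory Num.Theory.
Import numFieldNormedType.Exports.

Local Open Scope classical_set_scope.
Local Open Scope ring_scope.

(* The topological dual of X, as a normed space for the operator norm. *)
Section Dual.
Context {R : realType} {X : normedModType R}.

Definition continuous_linear : {pred (X -> R^o)} :=
  fun p => `[< linear p /\ continuous p >].

Lemma continuous_linear_submod_closed : submod_closed continuous_linear.
Proof.
split.
- apply/asboolP; split; last exact: cst_continuous.
  by move=> a u v; rewrite /GRing.zero/= scaler0 addr0.
- move=> a p q /asboolP[lp cp] /asboolP[lq cq]; apply/asboolP; split.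
  + move=> b u v.
    have E w : (a *: p + q) w = a *: p w + q w by [].
    by rewrite !E lp lq !scalerDr !scalerA (mulrC a b) addrACA.
  + move=> x; apply: continuousD; last exact: cq.
    by apply: continuousZl_tmp => //; exact: cp.
Qed.

HB.instance Definition _ := GRing.isSubmodClosed.Build R (X -> R^o)
  continuous_linear continuous_linear_submod_closed.

Record dual := Dual {
  dual_fun :> X -> R^o ;
  dual_funP : dual_fun \in continuous_linear }.

HB.instance Definition _ := [isSub for dual_fun].
HB.instance Definition _ := [Choice of dual by <:].
HB.instance Definition _ := [SubChoice_isSubLmodule of dual by <:].

Lemma dual_linear (p : dual) : linear p.
Proof. by case: p => p /= /asboolP[]. Qed.

Lemma dual_continuous (p : dual) : continuous p.
Proof. by case: p => p /= /asboolP[]. Qed.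

HB.instance Definition _ (p : dual) :=
  GRing.isLinear.Build R X R^o *:%R (dual_fun p) (@dual_linear p).

Definition dual_norm (p : dual) : R :=
  sup [set `|p x| | x in [set x : X | `|x| <= 1]].

Lemma dual_norm_has_sup (p : dual) :
  has_sup [set `|p x| | x in [set x : X | `|x| <= 1]].
Proof.
split; first by exists `|p 0|; exists 0 => //=; rewrite normr0.
have /linear_bounded_continuous/linear_boundedP : continuous p.
  exact: dual_continuous.
move=> /pinfty_ex_gt0[r r0 pr]; exists r => _ [x /= x1 <-].
by rewrite (le_trans (pr x))// ler_piMr// ltW.
Qed.

Lemma ler_dual_norm (p : dual) (x : X) : `|p x| <= dual_norm p * `|x|.
Proof.
have [->|x0] := eqVneq x 0; first by rewrite linear0 !normr0 mulr0.
have nx0 : 0 < `|x| by rewrite normr_gt0.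
rewrite -ler_pdivrMr//.
have -> : `|p x| / `|x| = `|p (`|x|^-1 *: x)|.
  by rewrite linearZ/= normrZ gtr0_norm ?invr_gt0// mulrC.
apply: ub_le_sup; first exact: (dual_norm_has_sup p).2.
exists (`|x|^-1 *: x) => //=.
by rewrite normrZ gtr0_norm ?invr_gt0// mulVf// gt_eqF.
Qed.

Lemma dual_norm_ge0 (p : dual) : 0 <= dual_norm p.
Proof.
apply: le_trans (normr_ge0 (p 0)) _; apply: ub_le_sup.
  exact: (dual_norm_has_sup p).2.
by exists 0 => //=; rewrite normr0.
Qed.

Lemma dual_norm_le (p : dual) (r : R) :
  (forall x, `|x| <= 1 -> `|p x| <= r) -> dual_norm p <= r.
Proof.
move=> pr; apply: ge_sup; first exact: (dual_norm_has_sup p).1.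
by move=> _ [x /= x1 <-]; exact: pr.
Qed.

Lemma ler_dual_normD (p q : dual) :
  dual_norm (p + q) <= dual_norm p + dual_norm q.
Proof.
apply: dual_norm_le => x x1; rewrite (le_trans (ler_normD (p x) (q x)))//.
apply: lerD; apply: (le_trans (ler_dual_norm _ _)).
- by rewrite ler_piMr// dual_norm_ge0.
- by rewrite ler_piMr// dual_norm_ge0.
Qed.

Lemma dual_normZ (a : R) (p : dual) : dual_norm (a *: p) = `|a| * dual_norm p.
Proof.
have le_normZ b q : dual_norm (b *: q) <= `|b| * dual_norm q.
  apply: dual_norm_le => x x1.
  have -> : (b *: q) x = b *: q x by [].
  rewrite normrZ ler_wpM2l// (le_trans (ler_dual_norm _ _))//.
  by rewrite ler_piMr// dual_norm_ge0.
apply/eqP; rewrite eq_le le_normZ/=.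
have [->|a0] := eqVneq a 0; first by rewrite normr0 mul0r dual_norm_ge0.
rewrite -ler_pdivlMl ?normr_gt0// -normfV.
by have := le_normZ a^-1 (a *: p); rewrite scalerA mulVf// scale1r.
Qed.

Lemma dual_norm0_eq0 (p : dual) : dual_norm p = 0 -> p = 0.
Proof.
move=> p0; apply: val_inj; apply/funext => x /=; apply/eqP.
by rewrite -normr_le0 (le_trans (ler_dual_norm p x))// p0 mul0r.
Qed.

HB.instance Definition _ := Lmodule_isNormed.Build R dual
  ler_dual_normD dual_normZ dual_norm0_eq0.

End Dual.
Arguments dual {R} X.

Section Definitions.
Context {R : realType} {X : normedModType R}.
Implicit Types (f : X -> \bar R) (x y v : X).

Definition edom f : set X := [set x | f x \is a fin_num].

Definition segment x y : set X := [set x + t *: (y - x) | t in `[0, 1]].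

Definition locally_lipschitz f :=
  forall x, edom f x -> exists U : set X,
    [/\ open_nbhs x U, U `<=` edom f & [lipschitz (fine (f y) : R^o) | y in U]].

(* The filter of (y, alpha) tending to (x, f x) with f y <= alpha. *)
Definition epi_nbhs f x : set_system (X * R) :=
  within [set p | (f p.1 <= p.2%:E)%E] (nbhs (x, fine (f x))).

Definition clarke_rockafellar f x v : \bar R :=
  ereal_sup [set
    limf_esup
      (fun p : X * R * R => let: (y, alpha, t) := p in
        ereal_inf [set ((f (y + t *: u)%R - alpha%:E) * t^-1%:E)%E
                   | u in ball v e])
      (filter_prod (epi_nbhs f x) 0^'+)
    | e in [set e : R | 0 < e]].

Definition subdifferential f x : set (dual X) :=
  [set p | edom f x /\ forall v, ((p v)%:E <= clarke_rockafellar f x v)%E].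

Definition self_segment_dense (U V : set X) :=
  V `<=` closure U /\
  forall x y, U x -> U y -> segment x y `<=` closure (segment x y `&` U).

Definition strictly_pseudoconvex_on (S : set X) f :=
  forall x y, S x -> S y -> x <> y -> (f y <= f x)%E ->
    forall p, subdifferential f x p -> p (y - x) < 0.

Definition strictly_pseudoconvex f := strictly_pseudoconvex_on (edom f) f.

Definition locally_strictly_pseudoconvex (D : set X) f :=
  forall z, D z -> exists2 U : set X,
    open_nbhs z U & strictly_pseudoconvex_on (U `&` D) f.

End Definitions.

(* Only points y of the domain of T, where T y is nonempty, are constrained. *)
Definition lower_semicontinuous_map (S Y : topologicalType) (T : S -> set Y) :=
  forall x, T x !=set0 -> forall N : set Y, open N -> T x `&` N !=set0 ->
    \forall y \near x, T y !=set0 -> T y `&` N !=set0.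

(* Main.v *)
From HB Require Import structures.
Require Import Defs.
From mathcomp Require Import all_boot all_order all_algebra.
From mathcomp Require Import all_classical all_reals all_analysis.
From mathcomp Require Import lra.

(* If z lies outside D, the last hypothesis, applied to all segments through z,
   says that every subgradient at z is injective.  Hence a subgradient at z that
   vanishes on a direction d <> 0 forces z to be in D.  By Hahn-Banach, such a
   subgradient exists as soon as the Clarke derivatives of f at z along d and
   - d are both nonnegative, which happens when f (z + t d) <= f z for small
   t > 0 and the derivative along d is nonnegative; local strict
   pseudoconvexity at z then gives a contradiction, since D meets the ray from
   z along d arbitrarily close to z.  If f y <= f x and a subgradient at x is
   nonnegative on d = y - x, this situation occurs at x when f is maximal at x
   on [x, y], and at an interior maximum point otherwise. *)

Import Order.TTheory GRing.Theory Num.Theory.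
Import numFieldNormedType.Exports.

Local Open Scope classical_set_scope.
Local Open Scope ring_scope.

(** * Sublinear functionals and a Hahn-Banach theorem *)

Definition sublinear_functional {R : realType} {V : lmodType R} (p : V -> R) :=
  (forall u v, p (u + v) <= p u + p v) /\
  (forall c v, 0 < c -> p (c *: v) <= c * p v).

Section Sublinear.
Context {R : realType} {V : lmodType R}.
Implicit Types (p : V -> R) (u v d : V).

Lemma sublinearZ p c v : sublinear_functional p -> 0 < c ->
  p (c *: v) = c * p v.
Proof.
move=> [_ pZ] c0; apply/eqP; rewrite eq_le pZ//= -ler_pdivlMl//.
have := pZ c^-1 (c *: v); rewrite scalerA mulVf ?gt_eqF// scale1r invr_gt0.
exact.
Qed.

Lemma sublinear0 p : sublinear_functional p -> p 0 = 0.
Proof. by move=> /(@sublinearZ _ 2 0) /(_ ltac:(lra)); rewrite scaler0; lra. Qed.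

Lemma sublinear_opp_ge p v : sublinear_functional p -> - p (- v) <= p v.
Proof.
move=> sp; have := sp.1 v (- v); rewrite subrr sublinear0//; lra.
Qed.

(** Subadditivity for [(u + v) + (- v)] gives the reverse inequality once [p] is odd; oddness also
    extends homogeneity to negative scalars. *)
Lemma sublinear_odd_linear p : sublinear_functional p ->
  (forall v, p (- v) <= - p v) -> linear (p : V -> R^o).
Proof.
move=> sp podd; have pN v : p (- v) = - p v.
  apply/eqP; rewrite eq_le podd/=.
  by have := sublinear_opp_ge _ v sp; lra.
have pD u v : p (u + v) = p u + p v.
  apply/eqP; rewrite eq_le sp.1/=.
  by have := sp.1 (u + v) (- v); rewrite addrK pN; lra.
have pZ c v : p (c *: v) = c * p v.
  have [c0|c0|->] := ltgtP c 0; last by rewrite scale0r sublinear0// mul0r.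
    rewrite -[c]opprK scaleNr pN (sublinearZ _ _ _ sp) ?oppr_gt0//; lra.
  exact: sublinearZ.
by move=> c u v; rewrite pD pZ.
Qed.

(* The witness is [inf_s p (v + s d) - s c], the largest sublinear minorant
   with slope at most [c] in direction [d] and [- c] in direction [- d]. *)
Lemma sublinear_prescribe p d c : sublinear_functional p ->
  c <= p d -> - c <= p (- d) ->
  exists p', [/\ sublinear_functional p', forall v, p' v <= p v,
    p' d <= c & p' (- d) <= - c].
Proof.
move=> sp cd cNd.
pose E v := [set p (v + s *: d) - s * c | s in setT].
have lbE v : lbound (E v) (- p (- v)).
  move=> _ [s _ <-].
  (* The bound on [p d] serves [s > 0], the one on [p (- d)] serves [s < 0]. *)
  have psd : s * c <= p (s *: d).
    have [s0|s0|->] := ltgtP s 0; last by rewrite scale0r sublinear0// mul0r.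
      rewrite -[s]opprK scaleNr -scalerN (sublinearZ _ _ _ sp) ?oppr_gt0//.
      rewrite mulNr -mulrN ler_pM2l//; lra.
    by rewrite (sublinearZ _ _ _ sp)// ler_pM2l.
  by have := sp.1 (- v) (v + s *: d); rewrite addKr; lra.
have E0 v : E v !=set0 by exists (p (v + 0 *: d) - 0 * c), 0.
have leE v s : inf (E v) <= p (v + s *: d) - s * c.
  by apply: ge_inf; [exists (- p (- v)); exact: lbE|exists s].
exists (fun v => inf (E v)); split.
- split=> [u v|a v a0].
    rewrite -lerBlDr; apply: lb_le_inf => // _ [s _ <-].
    rewrite lerBlDr -lerBlDl; apply: lb_le_inf => // _ [t _ <-].
    rewrite lerBlDl (le_trans (leE _ (s + t)))// mulrDl scalerDl addrACA.
    by have := sp.1 (u + s *: d) (v + t *: d); lra.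
  rewrite -ler_pdivrMl//; apply: lb_le_inf => // _ [s _ <-].
  rewrite ler_pdivrMl// (le_trans (leE _ (a * s)))// -scalerA -scalerDr.
  by rewrite (sublinearZ _ _ _ sp)// mulrBr mulrA.
- by move=> v; have := leE v 0; rewrite scale0r addr0; lra.
- by have := leE d (- 1); rewrite scaleN1r subrr sublinear0//; lra.
- by have := leE (- d) 1; rewrite scale1r addNr sublinear0//; lra.
Qed.

(** Bounds the chains in Zorn's lemma. The pointwise infimum stays above [- p (- v)]; it is
    subadditive because the smaller of two members of the chain can be used at both [u] and [v]. *)
Lemma sublinear_chain_inf p (A : set (V -> R)) : sublinear_functional p ->
  A !=set0 -> (forall q, A q -> sublinear_functional q) ->
  (forall q v, A q -> q v <= p v) ->
  (forall q r, A q -> A r ->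
    (forall v, q v <= r v) \/ (forall v, r v <= q v)) ->
  exists m, [/\ sublinear_functional m, forall v, m v <= p v &
    forall q v, A q -> m v <= q v].
Proof.
move=> sp [q0 Aq0] sA Ap tA; pose E v := [set q v | q in A].
have lbE v : lbound (E v) (- p (- v)).
  move=> _ [q Aq <-]; have := sublinear_opp_ge _ v (sA _ Aq).
  by have := Ap _ (- v) Aq; lra.
have E0 v : E v !=set0 by exists (q0 v), q0.
have leE v q : A q -> inf (E v) <= q v.
  by move=> Aq; apply: ge_inf; [exists (- p (- v)); exact: lbE|exists q].
exists (fun v => inf (E v)); split => [|v|q v Aq]; last exact: leE.
- split=> [u v|a v a0].
    rewrite -lerBlDr; apply: lb_le_inf => // _ [q Aq <-].
    rewrite lerBlDr -lerBlDl; apply: lb_le_inf => // _ [r Ar <-].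
    rewrite lerBlDl; have [qr|rq] := tA _ _ Aq Ar.
      have := (sA _ Aq).1 u v; have := leE (u + v) _ Aq; have := qr v; lra.
    by have := (sA _ Ar).1 u v; have := leE (u + v) _ Ar; have := rq u; lra.
  rewrite -ler_pdivrMl//; apply: lb_le_inf => // _ [q Aq <-].
  by rewrite ler_pdivrMl// -(sublinearZ _ _ _ (sA _ Aq))// leE.
- exact: le_trans (leE v _ Aq0) (Ap _ _ Aq0).
Qed.

(* A pointwise minimal sublinear functional is linear, since
   [sublinear_prescribe] with [c := m d] cannot lower it. *)
Lemma hahn_banach_sublinear p d c : sublinear_functional p ->
  c <= p d -> - c <= p (- d) ->
  exists q : V -> R, [/\ linear (q : V -> R^o), forall v, q v <= p v & q d = c].
Proof.
move=> sp cd cNd.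
have [p1 [sp1 p1p p1d p1Nd]] := sublinear_prescribe _ _ _ sp cd cNd.
pose T := {q : V -> R | sublinear_functional q /\ forall v, q v <= p1 v}.
(* The order is reversed, so that a maximal element is a pointwise minimal functional. *)
pose le_op (q r : T) := `[< forall v, sval r v <= sval q v >].
have [| | | |[m [sm mp1]] mmin] := @Zorn T le_op.
- by move=> q; apply/asboolP.
- move=> q r s /asboolP rq /asboolP sr; apply/asboolP => v.
  exact: le_trans (sr v) (rq v).
- move=> [q qP] [r rP] /asboolP/= rq /asboolP/= qr; apply: eq_exist.
  by apply/funext => v; apply/eqP; rewrite eq_le qr rq.
- move=> A tA; have [->|/set0P[q0 Aq0]] := eqVneq A set0.
    by exists (exist _ p1 (conj sp1 (fun v => lexx _))).
  have [| | | |m [sm mp1 mA]] := @sublinear_chain_inf p1 (sval @` A) sp1.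
  + by exists (sval q0), q0.
  + by move=> _ [q _ <-]; exact: (svalP q).1.
  + by move=> _ v [q _ <-]; exact: (svalP q).2.
  + move=> _ _ [q Aq <-] [r Ar <-].
    by have [/asboolP ?|/asboolP ?] := tA _ _ Aq Ar; [right|left].
  exists (exist _ m (conj sm mp1)) => q Aq; apply/asboolP => v /=.
  by apply: mA; exists q.
have modd v : m (- v) <= - m v.
  have [|m' [sm' m'm _ m'N]] := sublinear_prescribe _ v (m v) sm (lexx _).
    by have := sublinear_opp_ge _ v sm; lra.
  pose t : T := exist _ m' (conj sm' (fun w => le_trans (m'm w) (mp1 w))).
  have m'E : m' = m := congr1 sval (mmin t (asboolT m'm)).
  by rewrite -{1}m'E.
exists m; split; first exact: sublinear_odd_linear.
  by move=> v; exact: le_trans (mp1 v) (p1p v).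
apply/eqP; rewrite eq_le (le_trans (mp1 d) p1d)/=.
by have := sublinear_opp_ge _ d sm; have := mp1 (- d); lra.
Qed.

End Sublinear.

(** * The Clarke derivative of a real-valued function *)

Section Clarke.
Context {R : realType} {X : normedModType R}.
Implicit Types (F : X -> R) (z v w d : X) (M : R).

(** Multiplying by the step [p.2], positive along [0^'+], avoids the quotient. The base point [p.1]
    varies together with the step. *)
Definition slope_bound F z v M :=
  \forall p \near filter_prod (nbhs z) 0^'+,
    F (p.1 + p.2 *: v) - F p.1 <= M * p.2.

(* The Clarke derivative, limsup of (F (y + t v) - F y) / t, as the infimum of
   the eventual upper bounds of the slopes; it is junk when there are none. *)
Definition clarke F z v : R := inf [set M | slope_bound F z v M].

Lemma near_step z (r c : R) : 0 < r ->
  \forall p \near filter_prod (nbhs z) 0^'+,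
    0 < p.2 /\ forall u, `|u| <= c -> `|p.1 + p.2 *: u - z| < r.
Proof.
move=> r0; have r20 : 0 < r / 2 by lra.
have c10 : 0 < `|c| + 1 by have := normr_ge0 c; lra.
(* Half of [r] is for the base point and half for the step; [+ 1] keeps the denominator positive
   when [c = 0]. *)
exists (ball z (r / 2), [set t | 0 < t < r / 2 / (`|c| + 1)]).
  split => /=; first exact: nbhsx_ballx.
  near=> t; apply/andP; split=> //; near: t.
  by apply: nbhs_right_lt; rewrite divr_gt0.
move=> [y t] /= [yz /andP[t0 tc]]; split => // u uc.
rewrite addrAC (le_lt_trans (ler_normD _ _))//.
move: yz; rewrite -ball_normE/= distrC normrZ gtr0_norm// => yz.
move: tc; rewrite ltr_pdivlMr// => tc.
have : t * `|u| <= t * (`|c| + 1).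
  by rewrite ler_pM2l//; have := ler_norm c; lra.
lra.
Unshelve. all: by end_near. Qed.

(** The filter absorbs a base point that moves with the step, which is what makes slope bounds
    subadditive. *)
Lemma cvg_shift z w :
  (fun p : X * R => (p.1 + p.2 *: w, p.2)) @ filter_prod (nbhs z) 0^'+ -->
  filter_prod (nbhs z) 0^'+.
Proof.
apply: (@cvg_pair _ _ _ (filter_prod (nbhs z) 0^'+) (nbhs z) 0^'+ _ _ _
  (fun p : X * R => p.1 + p.2 *: w) snd); last exact: cvg_snd.
apply/cvgrPdist_lt => e e0; have := near_step z e `|w| e0.
by apply: filterS => -[y t] [_ /(_ w (lexx _))]; rewrite distrC.
Qed.

Lemma near_ray z w (A : set X) : nbhs z A ->
  \forall t \near 0^'+, A (z + t *: w).
Proof.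
have : z + t *: w @[t --> (0 : R)^'+] --> z + (0 : R) *: w.
  apply: cvgD; first exact: cvg_cst.
  by apply: cvgZr_tmp; apply: cvg_at_right_filter; exact: cvg_id.
by rewrite scale0r addr0; apply.
Qed.

Lemma cvg_ray z w :
  (fun t : R => (z + t *: w, t)) @ 0^'+ --> filter_prod (nbhs z) 0^'+.
Proof.
apply: (@cvg_pair _ _ _ 0^'+ (nbhs z) 0^'+ _ _ _ (fun t => z + t *: w) id);
  last exact: cvg_id.
by move=> A; exact: near_ray.
Qed.

(** The increment telescopes through [p.1 + p.2 *: w], where the bound for [v] is applied. *)
Lemma slope_boundD F z v w M N : slope_bound F z v M -> slope_bound F z w N ->
  slope_bound F z (v + w) (M + N).
Proof.
move=> vM wN; have := cvg_shift z w _ vM; rewrite /slope_bound /= => vM'.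
apply: (@filterS2 _ (filter_prod (nbhs z) 0^'+) _ _ _ _ _ vM' wN) => p /=.
rewrite scalerDr (addrC (_ *: v)) addrA; lra.
Qed.

(** The bound for [v] is used with step [p.2 * c]. *)
Lemma slope_boundZ F z v M c : 0 < c -> slope_bound F z v M ->
  slope_bound F z (c *: v) (c * M).
Proof.
move=> c0 vM; have h : (p.1, p.2 * c) @[p --> filter_prod (nbhs z) (0 : R)^'+] -->
    filter_prod (nbhs z) 0^'+.
  apply: (@cvg_pair _ _ _ (filter_prod (nbhs z) 0^'+) (nbhs z) 0^'+ _ _ _
    fst (fun p : X * R => p.2 * c)); first exact: cvg_fst.
  apply: (@cvg_comp _ _ _ snd ( *%R^~ c) _ (0^'+) (0^'+)); first exact: cvg_snd.
  move=> P [e /= e0 eP]; exists (e / c) => /= [|t]; first exact: divr_gt0.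
  rewrite /= sub0r normrN ltr_pdivlMr// => te t0.
  apply: eP; last exact: mulr_gt0.
  by rewrite /= sub0r normrN normrM (gtr0_norm c0).
apply: (@filterS _ (filter_prod (nbhs z) 0^'+) _ _ _ _ (h _ vM)) => -[y t] /=.
by rewrite scalerA (mulrC c M) mulrAC mulrA.
Qed.

(** The point [z + t *: - d] is an admissible base point, and a step [t] along [d] from it ends at
    [z], where [F] is at least as large. *)
Lemma slope_bound_ge0 F z d M :
  (\forall t \near 0^'+, F (z + t *: - d) <= F z) -> slope_bound F z d M ->
  0 <= M.
Proof.
move=> Fd dM; have dM' : \forall t \near 0^'+,
    F (z + t *: - d + t *: d) - F (z + t *: - d) <= M * t.
  exact: cvg_ray dM.
have [t [Ft [Mt t0]]] := filter_ex (filterI Fd (filterI dM' (nbhs_right_gt 0))).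
move: Ft Mt; rewrite /= scalerN subrK => Ft Mt.
by rewrite -(pmulr_lge0 _ t0); lra.
Qed.

Section LipschitzNear.
Variables (F : X -> R) (z : X) (r k : R).
Hypotheses (r0 : 0 < r) (k0 : 0 < k).
Hypothesis Flip : forall y y', `|y - z| < r -> `|y' - z| < r ->
  `|F y - F y'| <= k * `|y - y'|.

Lemma slope_near v : \forall p \near filter_prod (nbhs z) 0^'+,
  0 < p.2 /\ `|F (p.1 + p.2 *: v) - F p.1| <= k * `|v| * p.2.
Proof.
have := near_step z r `|v| r0; apply: filterS => -[y t] [/= t0 yt]; split=> //.
have := yt v (lexx _); have := yt 0; rewrite normr0 normr_ge0 scaler0 addr0.
move=> /(_ isT) h0 h1; have := Flip _ _ h1 h0.
by rewrite addrAC subrr add0r normrZ gtr0_norm// mulrA mulrAC.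
Qed.

(** With [slope_bound_ge], this makes the infimum in [clarke] that of a nonempty set bounded
    below. *)
Lemma slope_bound_lip v : slope_bound F z v (k * `|v|).
Proof.
have := slope_near v; apply: filterS => p [_]; exact/le_trans/ler_norm.
Qed.

Lemma slope_bound_ge v M : slope_bound F z v M -> - (k * `|v|) <= M.
Proof.
move=> vM; have [p [h' [p0]]] := filter_ex (filterI vM (slope_near v)).
rewrite ler_norml => /andP[h _].
by rewrite -(ler_pM2r p0); move: h'; rewrite /=; lra.
Qed.

Lemma near_lt_radius : \forall y \near z, `|y - z| < r.
Proof. by apply/nbhs_normP; exists r => //= y /=; rewrite distrC. Qed.

Lemma lipschitz_near_continuous : {for z, continuous F}.
Proof.
apply/cvgrPdist_lt => e e0; near=> y.
have yz : `|y - z| < r by near: y; exact: near_lt_radius.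
have zz : `|z - z| < r by rewrite subrr normr0.
rewrite (le_lt_trans (Flip _ _ zz yz))// mulrC -ltr_pdivlMr//.
near: y; apply/nbhs_normP; exists (e / k) => //=; exact: divr_gt0.
Unshelve. all: by end_near. Qed.

Lemma clarke_le v M : slope_bound F z v M -> clarke F z v <= M.
Proof.
move=> vM; apply: ge_inf => //.
by exists (- (k * `|v|)) => N; exact: slope_bound_ge.
Qed.

Lemma clarke_sublinear : sublinear_functional (clarke F z).
Proof.
have S0 v : [set M | slope_bound F z v M] !=set0.
  by exists (k * `|v|); exact: slope_bound_lip.
split=> [u v|c v c0].
  rewrite -lerBlDr; apply: lb_le_inf => // M uM.
  rewrite lerBlDr -lerBlDl; apply: lb_le_inf => // N vN.
  by rewrite lerBlDl clarke_le//; exact: slope_boundD.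
rewrite -ler_pdivrMl//; apply: lb_le_inf => // M vM.
by rewrite ler_pdivrMl// clarke_le//; exact: slope_boundZ.
Qed.

Lemma clarke_ge0 d :
  (\forall t \near 0^'+, F (z + t *: - d) <= F z) -> 0 <= clarke F z d.
Proof.
move=> Fd; apply: lb_le_inf => [|M].
  by exists (k * `|d|); exact: slope_bound_lip.
exact: slope_bound_ge0.
Qed.

End LipschitzNear.

(** * Comparison of the Clarke-Rockafellar and Clarke derivatives *)

Section ClarkeRockafellar.
Variables (f : X -> \bar R) (z : X) (r k : R).
Hypotheses (r0 : 0 < r) (k0 : 0 < k).
Hypothesis f_fin : forall y, `|y - z| < r -> f y \is a fin_num.
Let F := fine \o f.
Hypothesis Flip : forall y y', `|y - z| < r -> `|y' - z| < r ->
  `|F y - F y'| <= k * `|y - y'|.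

Let fE y : `|y - z| < r -> f y = (F y)%:E.
Proof. by move=> yz; rewrite /F/= fineK ?f_fin. Qed.

(** The infimum over the ball is at most the value at its centre [v], and [f y <= alpha] makes the
    quotient no larger than the slope of [F]. *)
Lemma clarke_rockafellar_le v M : slope_bound F z v M ->
  (clarke_rockafellar f z v <= M%:E)%E.
Proof.
move=> vM; apply: ge_ereal_sup => _ [e /= e0 <-].
apply: ge_ereal_inf.
pose V := [set p : X * R * R | [/\ 0 < p.2, (f p.1.1 <= p.1.2%:E)%E,
  `|p.1.1 - z| < r, `|p.1.1 + p.2 *: v - z| < r &
  F (p.1.1 + p.2 *: v) - F p.1.1 <= M * p.2]].
exists (ereal_sup ((fun p : X * R * R => let: (y, alpha, t) := p in
  ereal_inf [set ((f (y + t *: u)%R - alpha%:E) * t^-1%:E)%E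
            | u in ball v e]) @` V)).
  exists V => //; have : \forall p \near filter_prod (nbhs z) 0^'+,
      [/\ 0 < p.2, `|p.1 - z| < r, `|p.1 + p.2 *: v - z| < r &
  F (p.1 + p.2 *: v) - F p.1 <= M * p.2].
    apply: (@filterS2 _ (filter_prod (nbhs z) 0^'+) _ _ _ _ _
      (near_step z r `|v| r0) vM) => p [p0 pr] pM.
    split => //; last exact: pr.
    by have := pr 0; rewrite scaler0 addr0 normr0; exact.
  move=> [[A B] /= [zA B0] AB].
  exists ([set q : X * R | A q.1 /\ (f q.1 <= q.2%:E)%E], B).
    split => //=; exists (A, setT) => /=; first by split => //; exact: filterT.
    by move=> q [Aq _] /= fq.
  move=> [[y a] t] /= [[Ay fya] Bt].
  by have [] := AB (y, t) (conj Ay Bt); split.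
apply: ge_ereal_sup => _ [[[y a] t] [/= t0 fya yr ytr h] <-].
apply: ge_ereal_inf; exists ((f (y + t *: v)%R - a%:E) * t^-1%:E)%E.
  by exists v => //; exact: ballxx.
rewrite fE// -EFinB -EFinM lee_fin ler_pdivrMr//.
by move: fya; rewrite fE// lee_fin; lra.
Qed.

(** Permits the choice [alpha := F y] in the upper limit, so that steep slopes of [F] are seen by
    the Clarke-Rockafellar derivative. *)
Lemma cvg_graph : (y, F y) @[y --> z] --> epi_nbhs f z.
Proof.
have Fc := lipschitz_near_continuous F z r k r0 k0 Flip.
move=> P zP; have P' : \forall y \near z,
    (f y <= (F y)%:E)%E -> P (y, F y).
  have h : (y, F y) @[y --> z] --> (z, F z)
    by apply: (@cvg_pair _ _ _ (nbhs z) (nbhs z) (nbhs (F z)) _ _ _ id F).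
  exact: (h _ zP).
move: P' (near_lt_radius z r r0); apply: filterS2 => y yP yr.
by apply: yP; rewrite fE.
Qed.

(** The supremum over radii allows a ball so small that, by the Lipschitz estimate, replacing [v] by
    any [u] in it hardly changes the slope. *)
Lemma clarke_rockafellar_ge v a : a <= clarke F z v ->
  (a%:E <= clarke_rockafellar f z v)%E.
Proof.
move=> av; apply/lee_addgt0Pr => n n0.
(* Half of the tolerance [n] goes to finding a steep slope; the other half is [k * e], which bounds
   the slope change over the ball. *)
have e0 : 0 < n / 2 / k by rewrite !divr_gt0.
pose e := n / 2 / k.
rewrite -leeBlDr//; apply: le_trans; last first.
  apply: ereal_sup_ubound; exists e => //; reflexivity.
apply: le_ereal_inf_tmp => _ [V VF <-].
have epiF : Filter (epi_nbhs f z) by exact: within_filter.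
have hF : ((p.1, F p.1), p.2) @[p --> filter_prod (nbhs z) (0 : R)^'+] -->
   filter_prod (epi_nbhs f z) (0 : R)^'+.
  apply: (@cvg_pair _ _ _ (filter_prod (nbhs z) 0^'+) (epi_nbhs f z) 0^'+ _ _ _
    (fun p => (p.1, F p.1)) snd); last exact: cvg_snd.
  by apply: (@cvg_comp _ _ _ fst (fun y => (y, F y)) _ (nbhs z));
    [exact: cvg_fst|exact: cvg_graph].
have hV : \forall p \near filter_prod (nbhs z) 0^'+, V ((p.1, F p.1), p.2).
  exact: hF _ VF.
(* [a - n / 2] is strictly below the infimum [clarke F z v], so larger slopes occur in every set of
   the filter. *)
have hn : ~ slope_bound F z v (a - n / 2).
  move=> /(clarke_le F z r k r0 Flip _ _); lra.
have [[y t] [hVyt [t0 yt] h]] : exists p : X * R, [/\ V ((p.1, F p.1), p.2),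
  0 < p.2 /\ (forall u, `|u| <= `|v| + e -> `|p.1 + p.2 *: u - z| < r) &
  (a - n / 2) * p.2 < F (p.1 + p.2 *: v) - F p.1].
  apply: contrapT => hN; apply: hn; rewrite /slope_bound.
  apply: (@filterS2 _ (filter_prod (nbhs z) 0^'+) _ _ _ _ _ hV
    (near_step z r (`|v| + e) r0)) => p pV pr.
  by rewrite leNgt; apply/negP => hp; apply: hN; exists p.
apply: le_trans; last first.
  by apply: ereal_sup_ubound; exists ((y, F y), t) => //; reflexivity.
apply: le_ereal_inf_tmp => _ [u vu <-].
have uve : `|v - u| < e by move: vu; rewrite -ball_normE.
have ve : `|v| <= `|v| + e by rewrite lerDl ltW.
have ue : `|u| <= `|v| + e.
  have := ler_normD v (u - v); rewrite addrC subrK distrC; lra.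
rewrite fE ?yt// -EFinB -EFinM lee_fin ler_pdivlMr//.
have := Flip _ _ (yt _ ve) (yt _ ue).
rewrite opprD addrACA subrr add0r -scalerBr.
rewrite normrZ gtr0_norm// ler_norml => /andP[_].
have : k * (t * `|v - u|) <= t * (n / 2).
  rewrite mulrCA ler_pM2l// mulrC -ler_pdivlMr//; exact: ltW.
move: h => /=; lra.
Qed.
End ClarkeRockafellar.
End Clarke.

(** * Subgradients as linear minorants of the Clarke derivative *)

Section Subdifferential.
Context {R : realType} {X : normedModType R}.
Variable f : X -> \bar R.
Hypothesis f_lip : locally_lipschitz f.
Let F : X -> R := fine \o f.

Lemma locally_lipschitz_ball z : edom f z -> exists r k : R, [/\ 0 < r, 0 < k,
  forall y, `|y - z| < r -> f y \is a fin_num &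
  forall y y', `|y - z| < r -> `|y' - z| < r -> `|F y - F y'| <= k * `|y - y'|].
Proof.
move=> /f_lip[U [zU Uf /pinfty_ex_gt0[k k0 Uk]]].
have /nbhs_normP[r /= r0 rU] := open_nbhs_nbhs zU.
have inU y : `|y - z| < r -> U y by move=> yz; apply: rU; rewrite /= distrC.
exists r, k; split=> // [y /inU/Uf //|y y' /inU Uy /inU Uy'].
exact: (Uk (y, y')).
Qed.

Lemma edom_nbhs z : edom f z -> nbhs z (edom f).
Proof.
by move=> /f_lip[U [/open_nbhs_nbhs zU Uf _]]; exact: filterS zU.
Qed.

Lemma fine_continuous z : edom f z -> {for z, continuous F}.
Proof.
move=> /locally_lipschitz_ball[r [k [r0 k0 _ Flip]]].
exact: lipschitz_near_continuous F z r k r0 k0 Flip.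
Qed.

Lemma subdifferential_le_clarke z p v :
  subdifferential f z p -> p v <= clarke F z v.
Proof.
move=> [zf pv]; have [r [k [r0 k0 ff Flip]]] := locally_lipschitz_ball _ zf.
apply: lb_le_inf => [|M vM].
  by exists (k * `|v|); exact: (slope_bound_lip F z r k r0 Flip).
rewrite -lee_fin; apply: le_trans (pv v) _.
exact: (clarke_rockafellar_le f z r r0 ff v M vM).
Qed.

(** The Lipschitz bound on [clarke], taken at [v] and [- v], makes [q] continuous. This is the
    converse of [subdifferential_le_clarke]. *)
Lemma subdifferential_linear z (q : X -> R) :
  edom f z -> linear (q : X -> R^o) ->
  (forall v, q v <= clarke F z v) ->
  exists2 p : dual X, subdifferential f z p & p = q :> (X -> R).
Proof.
move=> zf ql qF; have [r [k [r0 k0 ff Flip]]] := locally_lipschitz_ball _ zf.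
pose Q : {linear X -> R^o} := HB.pack (q : X -> R^o)
  (GRing.isLinear.Build _ _ _ _ (q : X -> R^o) ql).
have qle v : q v <= k * `|v|.
  apply: le_trans (qF v) _; apply: (clarke_le F z r k r0 Flip).
  exact: (slope_bound_lip F z r k r0 Flip).
have qN v : q (- v) = - q v := linearN Q v.
have Qc : continuous Q.
  apply/linear_bounded_continuous/linear_boundedP; near=> M => v.
  have kM : k <= M by near: M; apply: nbhs_pinfty_ge; exact: num_real.
  rewrite (@le_trans _ _ (k * `|v|))// ?ler_wpM2r// ler_norml qle andbT.
  by have := qle (- v); rewrite normrN qN /=; lra.
have Qd : (q : X -> R^o) \in continuous_linear by apply/asboolP.
exists (Dual Qd) => //; split => // v.
exact: (clarke_rockafellar_ge f z r k r0 k0 ff Flip v _ (qF v)).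
Unshelve. all: by end_near. Qed.

(** The two sign conditions are those of [hahn_banach_sublinear] for the prescribed value [0]. *)
Lemma subgradient_orthogonal z d : edom f z ->
  0 <= clarke F z d -> 0 <= clarke F z (- d) ->
  exists2 p : dual X, subdifferential f z p & p d = 0.
Proof.
move=> zf d0 Nd0; have [r [k [r0 k0 ff Flip]]] := locally_lipschitz_ball _ zf.
have [|q [ql qF qd]] := @hahn_banach_sublinear _ _ (clarke F z) d 0
  (clarke_sublinear F z r k r0 Flip) d0.
  by rewrite oppr0.
have [p pf pq] := subdifferential_linear _ _ zf ql qF.
by exists p => //; rewrite -qd -pq.
Qed.

Lemma subdifferential_nonempty z : edom f z -> subdifferential f z !=set0.
Proof.
move=> zf; have [r [k [r0 k0 ff Flip]]] := locally_lipschitz_ball _ zf.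
have F0 : clarke F z 0 = 0 := sublinear0 _ (clarke_sublinear F z r k r0 Flip).
have [||p pf _] := subgradient_orthogonal z 0 zf; last by exists p.
- by rewrite F0.
- by rewrite oppr0 F0.
Qed.

(** * Exclusion of descent directions with nonnegative derivative *)

Section Pseudoconvexity.
Variable D : set X.
Hypothesis D_dense : edom f `<=` closure D.
Hypothesis f_loc : locally_strictly_pseudoconvex D f.
Hypothesis D_neq0 : forall z p v, edom f z -> ~ D z -> subdifferential f z p ->
  v <> 0 -> p v <> 0.

(* If [w] is on the line but not in [D], a subgradient at [w] is injective, so
   the space is the line itself and density of [D] applies. *)
Lemma dense_on_lines z d (e : R) : edom f z -> d <> 0 -> 0 < e ->
  exists2 s : R, 0 < s < e & D (z + s *: d).
Proof.
move=> zf d0 e0.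
have [s [s0 [se sf]]] : exists s : R, 0 < s /\ s < e /\ edom f (z + s *: d).
  have zd : \forall t \near 0^'+, edom f (z + t *: d).
    by apply: near_ray; exact: edom_nbhs.
  have [s [? [? ?]]] := filter_ex (filterI (nbhs_right_gt 0)
    (filterI (nbhs_right_lt e0) zd)).
  by exists s.
set w := z + s *: d in sf *.
have [Dw|nDw] := pselect (D w); first by exists s => //; rewrite s0.
have [p pf] := subdifferential_nonempty _ sf.
have pd : p d != 0 by apply/eqP; exact: D_neq0 nDw pf d0.
(* Changing the parameter [s] by less than this keeps it between [0] and [e]. *)
have m0 : 0 < Num.min s (e - s) by rewrite lt_min s0 subr_gt0.
have pw : p w @[w --> w] --> p w by exact: dual_continuous.
have B : \forall u \near w, `|p w - p u| < Num.min s (e - s) * `|p d|.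
  by move/cvgrPdist_lt: pw; apply; rewrite mulr_gt0// normr_gt0.
have [u [Du]] := D_dense _ sf _ B.
rewrite /= distrC -ltr_pdivrMr ?normr_gt0// -normf_div.
(* [c] is such that [p] vanishes at [u - (w + c *: d)]; injectivity of [p] then puts [u] on the
   line. *)
set c := (_ / _) => cs.
have uE : u = w + c *: d.
  apply: contrapT => /eqP; rewrite -subr_eq0 => /eqP uw.
  apply: (D_neq0 _ _ _ sf nDw pf uw).
  rewrite opprD addrA linearB linearB linearZ/= /c.
  by rewrite [_ *: _]mulrVK ?unitfE// subrr.
exists (s + c); last by rewrite scalerDl addrA -uE.
move: cs; rewrite lt_min !ltr_norml; lra.
Qed.

(** A subgradient [q] with [q d = 0] exists, whereas pseudoconvexity between [z] and a point
    [z + s *: d] of [D] demands [q (s *: d) < 0]. *)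
Lemma no_descent_direction z d : edom f z -> d <> 0 ->
  (\forall t \near 0^'+, F (z + t *: d) <= F z) -> 0 <= clarke F z d -> False.
Proof.
move=> zf d0 Fd cd; have [r [k [r0 k0 ff Flip]]] := locally_lipschitz_ball _ zf.
have cNd : 0 <= clarke F z (- d).
  by apply: (clarke_ge0 F z r k r0 Flip); rewrite opprK.
have [q qf qd] := subgradient_orthogonal _ _ zf cd cNd.
have [Dz|nDz] := pselect (D z); last exact: D_neq0 nDz qf d0 qd.
have [U zU UD] := f_loc _ Dz.
have Fray : \forall t \near 0^'+, [/\ F (z + t *: d) <= F z, U (z + t *: d) &
    edom f (z + t *: d)].
  have Ud : \forall t \near 0^'+, U (z + t *: d).
    exact: near_ray _ d _ (open_nbhs_nbhs zU).
  have fd : \forall t \near 0^'+, edom f (z + t *: d).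
    exact: near_ray _ d _ (edom_nbhs _ zf).
  by move: Fd Ud fd; apply: filterS3.
have [e /= e0 He] := Fray.
have [s /andP[s0 se] Ds] := dense_on_lines _ _ _ zf d0 e0.
have [] := He s _ s0; first by rewrite /= sub0r normrN gtr0_norm.
move=> Fs Us fs.
have sd0 : s *: d != 0 by rewrite scaler_eq0 gt_eqF//; exact/eqP.
have zs : z <> z + s *: d.
  by move=> /eqP; rewrite -subr_eq0 opprD addrA subrr sub0r oppr_eq0
    (negPf sd0).
have fle : (f (z + s *: d)%R <= f z)%E.
  by rewrite -(fineK fs) -(fineK zf) lee_fin.
have := UD _ _ (conj zU.2 Dz) (conj Us Ds) zs fle q qf.
by rewrite addrAC subrr add0r linearZ/= qd scaler0 ltxx.
Qed.
End Pseudoconvexity.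
End Subdifferential.

(** * Maximum of the function on a segment *)

Lemma convex_edom_segment (R : realType) (X : normedModType R) (f : X -> \bar R)
    (x y : X) (t : R) :
  convex_set (edom f : set (convex_lmodType X)) -> edom f x -> edom f y ->
  0 <= t <= 1 -> edom f (x + t *: (y - x)).
Proof.
move=> cf xf yf /andP[t0 t1]; have := cf y x (Itv01 t0 t1).
have -> : x + t *: (y - x) = t *: y + (1 - t) *: x.
  by rewrite scalerBr scalerBl scale1r addrCA.
by rewrite !inE => /(_ yf xf).
Qed.

Theorem theorem4p3 (R : realType) (X : completeNormedModType R)
    (f : X -> \bar R) (D : set X)
    (f_gtNy : forall x, f x <> -oo%E)
    (f_lip : locally_lipschitz f)
    (dom_convex : convex_set (edom f : set (convex_lmodType X)))
    (D_dom : D `<=` edom f)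
    (D_dense : self_segment_dense D (edom f))
    (f_loc : locally_strictly_pseudoconvex D f)
    (df_lsc : lower_semicontinuous_map (subdifferential f))
    (df_neq0 : forall x y, edom f x -> edom f y -> x <> y ->
      forall z, segment x y z -> ~ D z ->
      forall p, subdifferential f z p -> p (x - y) <> 0) :
  strictly_pseudoconvex f.
Proof.
have D_neq0 z p v : edom f z -> ~ D z -> subdifferential f z p -> v <> 0 ->
    p v <> 0.
  move=> zf nDz pf v0 pv.
  (* The domain is open, so a short segment from [z] along [v] stays in it and has [z] as an
     endpoint. *)
  have zv : \forall t \near 0^'+, edom f (z + t *: v).
    by apply: near_ray; exact: edom_nbhs.
  have [t [t0 tf]] := filter_ex (filterI (nbhs_right_gt 0) zv).
  have tv0 : t *: v != 0 by rewrite scaler_eq0 gt_eqF//; exact/eqP.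
  apply: (df_neq0 _ _ zf tf _ z _ nDz _ pf).
  - by move=> /eqP; rewrite -subr_eq0 opprD addrA subrr sub0r oppr_eq0
    (negPf tv0).
  - by exists 0; rewrite /= ?in_itv/= ?lexx ?ler01// scale0r addr0.
  - by rewrite opprD addrA subrr sub0r linearN linearZ/= pv scaler0 oppr0.
have nodesc := no_descent_direction f f_lip D D_dense.1 f_loc D_neq0.
move=> x y xf yf xy fyx p pf; rewrite ltNge; apply/negP => pd.
pose F : X -> R := fine \o f; set d := y - x in pd.
have d0 : d <> 0 by move=> /eqP; rewrite subr_eq0 => /eqP /esym.
have Fyx : F y <= F x by rewrite -lee_fin /F/= !fineK.
have segf t : 0 <= t <= 1 -> edom f (x + t *: d).
  exact: convex_edom_segment.
have Fcont : {within `[0, 1], continuous (fun t => F (x + t *: d))}.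
  apply: continuous_in_subspaceT => t; rewrite inE/= in_itv/= => t01.
  apply: (@continuous_comp _ _ _ (fun t : R => x + t *: d) F);
    last exact: fine_continuous (segf _ t01).
  apply: cvgD; first exact: cvg_cst.
  by apply: cvgZr_tmp; exact: cvg_id.
have [c c01 cmax] := EVT_max ler01 Fcont.
have {}cmax t : 0 <= t <= 1 -> F (x + t *: d) <= F (x + c *: d).
  by move=> t01; apply: cmax; rewrite in_itv.
move: c01; rewrite in_itv/= => c01; have /andP[c0 c1] := c01.
(* If [x] is itself a maximum point, the values along [d] do not exceed [F x], and [0 <= p d] bounds
   the Clarke derivative from below. *)
have [cx|xc] := leP (F (x + c *: d)) (F x).
  apply: (nodesc x d xf d0); last first.
    exact: le_trans pd (subdifferential_le_clarke _ f_lip _ _ _ pf).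
  near=> t; apply: le_trans (cmax t _) cx; apply/andP; split.
    by near: t; exact: nbhs_right_ge.
  by near: t; apply: nbhs_right_le.
(* Otherwise the maximum exceeds [F x] and hence [F y], so [c] is interior. *)
have {}c0 : 0 < c.
  rewrite lt_neqAle c0 andbT; apply/eqP => c0'.
  by move: xc; rewrite -c0' scale0r addr0 ltxx.
have {}c1 : 0 < 1 - c.
  rewrite subr_gt0 lt_neqAle c1 andbT; apply/eqP => c1'.
  by move: xc; rewrite c1' scale1r /d addrC subrK ltNge Fyx.
have cf := segf _ c01.
apply: (nodesc _ d cf d0).
  near=> t; rewrite -addrA -scalerDl; apply: cmax.
  have : 0 < t by near: t; exact: nbhs_right_gt.
  have : t < 1 - c by near: t; exact: nbhs_right_lt.
  lra.
have [r [k [r0 k0 ff Flip]]] := locally_lipschitz_ball _ f_lip _ cf.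
(* Points just before the interior maximum have no larger value, so the derivative along [d] is
   nonnegative. *)
apply: (clarke_ge0 _ _ r k r0 Flip); near=> t.
rewrite scalerN -addrA -scalerBl; apply: cmax.
have : 0 < t by near: t; exact: nbhs_right_gt.
have : t < c by near: t; exact: nbhs_right_lt.
lra.
Unshelve. all: by end_near. Qed.
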